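(* Let $a,b,c\in\mathbb{C}$ be constants such that the function $$f(x)=b+a e^{-i2\pi x}+c e^{i2\pi x},\qquad x\in[0,1],$$ takes values in $[0,1]$, i.e. $f:[0,1]\to[0,1]$. Let $\{X_i\}_{i\in\mathbb{Z}}$ be a $\{0,1\}$-valued process with distribution $\mathbf{P}^f$, the determinantal probability measure on $\{0,1\}^{\mathbb{Z}}$ associated with $f$. Then $\{X_i\}_{i\in\mathbb{Z}}$ is a two-block-factor; that is, there exist an i.i.d. process $\{Y_i\}_{i\in\mathbb{Z}}$ and a (measurable) function $h$ of two variables such that $\{X_i\}_{i\in\mathbb{Z}}$ and $\{h(Y_i,Y_{i+1})\}_{i\in\mathbb{Z}}$ have the same distribution.
   Context: For a Lebesgue-measurable function $f:[0,1]\to[0,1]$, define its Fourier coefficients by $\hat f(k):=\int_0^1 f(x)e^{-i2\pi kx}\,dx$ for $k\in\mathbb{Z}$. The measure $\mathbf{P}^f$ is the probability measure on the Borel sets of $\{0,1\}^{\mathbb{Z}}$ determined by $$\mathbf{P}^f[\{\eta\in\{0,1\}^{\mathbb{Z}}:\eta(e_1)=\cdots=\eta(e_k)=1\}]=\det[\hat f(e_j-e_i)]_{1\le i,j\le k}$$ for all $k\ge 1$ and all distinct $e_1,\dots,e_k\in\mathbb{Z}$. (It is a known result of Lyons and Steif that such a probability measure exists for every such $f$; it is unique, since these probabilities determine the probabilities of all cylinder sets.) A process $\{X_i\}_{i\in\mathbb{Z}}$ is called an $m$-block-factor if there exist a (measurable) function $h$ of $m$ variables and an i.i.d. process $\{Y_i\}_{i\in\mathbb{Z}}$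 such that $\{X_i\}_{i\in\mathbb{Z}}$ and $\{h(Y_i,\ldots,Y_{i+m-1})\}_{i\in\mathbb{Z}}$ are equal in distribution (as processes indexed by $\mathbb{Z}$). A two-block-factor is the case $m=2$. *)

(* Defs.v *)
From HB Require Import structures.
From mathcomp Require Import all_boot all_order all_algebra.
From mathcomp Require Import finmap.
From mathcomp Require Import all_classical all_reals all_analysis.
From mathcomp Require Export complex.

Set Implicit Arguments.
Unset Strict Implicit.
Unset Printing Implicit Defensive.

Import Order.TTheory GRing.Theory Num.Theory.
Import numFieldNormedType.Exports.

Local Open Scope classical_set_scope.
Local Open Scope ring_scope.
Local Open Scope complex_scope.

Section fourier.
Variable R : realType.

(* e^{it} for real t *)
Definition expi (t : R) : R[i] := cos t +i* sin t.

Definition complex_integral (D : set R) (g : R -> R[i]) : R[i] :=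
  (\int[@lebesgue_measure R]_(x in D) complex.Re (g x))
  +i* (\int[@lebesgue_measure R]_(x in D) complex.Im (g x)).

Definition fourier_coef (f : R -> R) (k : int) : R[i] :=
  complex_integral `[0, 1] (fun x => (f x)%:C * expi (- (2 * pi * k%:~R * x))).

End fourier.

Section sequence_space.
Context d (T : measurableType d).

Definition coordinate_events : set (set (int -> T)) :=
  [set C | exists (i : int) (A : set T),
     measurable A /\ C = (fun x : int -> T => x i) @^-1` A].

(* T^Z with the product sigma-algebra. *)
Definition sequence_space := g_sigma_algebraType coordinate_events.

HB.instance Definition _ := Measurable.on sequence_space.

End sequence_space.

(* For T = {0,1} the product sigma-algebra is the Borel sigma-algebra of the
   product topology. *)
Lemma sequence_space_bool_borel :
  (measurable : set (set (sequence_space bool))) =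
  <<s (@open {ptws int -> bool}) >>.
Proof.
rewrite eqEsubset; split.
  apply: smallest_sub; first exact: smallest_sigma_algebra.
  move=> _ [i [A [_ ->]]]; apply: sub_sigma_algebra.
  apply: open_comp => [x _|]; last exact: discrete_open.
  exact: (@proj_continuous int (fun=> bool) i).
apply: smallest_sub; first exact: sigma_algebra_measurable.
move=> U oU.
pose C (s : seq (int * bool)) : set (int -> bool) :=
  [set x | all (fun p => x p.1 == p.2) s].
have mC s : measurable (C s : set (sequence_space bool)).
  elim: s => [|[i b] s IH].
    by rewrite (_ : C [::] = setT)//; apply/seteqP; split.
  rewrite (_ : C _ = (fun x : int -> bool => x i) @^-1` [set b] `&` C s).
    apply: measurableI => //; apply: sub_sigma_algebra.
    by exists i, [set b].
  apply/seteqP; split => x /=; first by move=> /andP[/eqP].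
  by move=> [xi xs]; apply/andP; split; [exact/eqP|exact: xs].
have CU x : U x -> exists s, C s x /\ C s `<=` U.
  move=> Ux.
  pose F : set_system {ptws int -> bool} :=
    fun A => exists s, C s x /\ C s `<=` A.
  have FF : Filter F.
    split.
    - by exists [::].
    - move=> A B [s [sx sA]] [t [tx tB]]; exists (s ++ t); split.
        by move: sx tx; rewrite /C/= all_cat => -> ->.
      move=> y; rewrite /C/= all_cat => /andP[sy ty].
      by split; [exact: sA|exact: tB].
    - move=> A B AB [s [sx sA]]; exists s; split => //.
      exact: subset_trans AB.
  have Fx : F --> (x : {ptws int -> bool}).
    apply/cvg_sup => i A; move=> [B [[V _ <-] /= Bx] BA].
    exists [:: (i, x i)]; rewrite /C /= eqxx; split => //.
    move=> y /=; rewrite andbT => /eqP yx; apply: BA => /=.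
    by rewrite /proj/= yx.
  by apply: Fx; exact: open_nbhs_nbhs.
pose G n := if choice.unpickle n is Some s
  then if `[< C s `<=` U >] then C s else set0 else set0.
have -> : U = \bigcup_(n in [set: nat]) G n.
  apply/seteqP; split => x.
    move=> /CU[s [sx sU]]; exists (choice.pickle s) => //.
    by rewrite /G choice.pickleK; case: asboolP.
  move=> [n _]; rewrite /G; case E : (choice.unpickle n) => [s|//].
  by case: asboolP => // sU /sU.
apply: (@bigcupT_measurable _ (sequence_space bool)) => n.
have m0 : measurable (set0 : set (sequence_space bool)) by exact: measurable0.
rewrite /G; case E : (choice.unpickle n) => [s|]; last exact: m0.
by case: asboolP => _; [exact: mC|exact: m0].
Qed.

Section processes.
Context (R : realType).

Definition path_of (I Omega T : Type) (X : I -> Omega -> T) :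
  Omega -> (I -> T) := fun w i => X i w.

Definition has_law d d' (Omega : measurableType d) (T : measurableType d')
    (P : probability Omega R) (X : int -> Omega -> T)
    (mu : probability (sequence_space T) R) : Prop :=
  forall B : set (sequence_space T), measurable B ->
    P (path_of X @^-1` B) = mu B.

Definition equal_in_law d1 d2 d' (Omega1 : measurableType d1)
    (Omega2 : measurableType d2) (T : measurableType d')
    (P1 : probability Omega1 R) (X1 : int -> Omega1 -> T)
    (P2 : probability Omega2 R) (X2 : int -> Omega2 -> T) : Prop :=
  forall B : set (sequence_space T), measurable B ->
    P1 (path_of X1 @^-1` B) = P2 (path_of X2 @^-1` B).

Definition independent_process d d' (Omega : measurableType d)
    (E : measurableType d') (P : probability Omega R)
    (Y : int -> Omega -> E) : Prop :=
  forall (J : {fset int}) (A : int -> set E),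
    (forall j, measurable (A j)) ->
    P (\bigcap_(j in [set` J]) (Y j @^-1` A j)) =
    (\prod_(j <- J) P (Y j @^-1` A j))%E.

Definition identically_distributed d d' (Omega : measurableType d)
    (E : measurableType d') (P : probability Omega R)
    (Y : int -> Omega -> E) : Prop :=
  forall (i j : int) (A : set E), measurable A ->
    P (Y i @^-1` A) = P (Y j @^-1` A).

Definition iid_process d d' (Omega : measurableType d)
    (E : measurableType d') (P : probability Omega R)
    (Y : int -> {RV P >-> E}) : Prop :=
  independent_process P Y /\ identically_distributed P Y.

(* The i.i.d. process may live on another probability space and take values in
   an arbitrary measurable space. *)
Definition block_factor (m : nat) d d' (Omega : measurableType d)
    (T : measurableType d') (P : probability Omega R)
    (X : int -> {RV P >-> T}) : Prop :=
  exists d1 (Omega' : measurableType d1) (P' : probability Omega' R)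
    d2 (E : measurableType d2) (Y : int -> {RV P' >-> E})
    (h : {mfun m.-tuple E >-> T}),
    iid_process Y /\
    equal_in_law P X P'
      (fun (i : int) (w : Omega') => h [tuple Y (i + k%:Z) w | k < m]).

Definition two_block_factor d d' (Omega : measurableType d)
    (T : measurableType d') (P : probability Omega R)
    (X : int -> {RV P >-> T}) : Prop := block_factor 2 X.

(* mu is P^f *)
Definition determinantal_measure (f : R -> R)
    (mu : probability (sequence_space bool) R) : Prop :=
  forall (k : nat) (e : 'I_k -> int), (0 < k)%N -> injective e ->
    (fine (mu [set eta : int -> bool | forall i, eta (e i) = true]))%:C =
    \det (\matrix_(i < k, j < k) fourier_coef f (e j - e i)).

End processes.

(* Main.v *)
Require Import Defs.
From mathcomp Require Import all_boot all_order all_algebra.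
From mathcomp Require Import finmap.
From mathcomp Require Import all_classical all_reals all_analysis.
From mathcomp Require Import measurable_realfun.
From mathcomp Require Import zify ring lra.

Set Implicit Arguments.
Unset Strict Implicit.
Unset Printing Implicit Defensive.

Import Order.TTheory GRing.Theory Num.Theory.
Import numFieldNormedType.Exports.

Local Open Scope classical_set_scope.
Local Open Scope ring_scope.
Local Open Scope complex_scope.

(** Write [f t = beta + u cos(2 pi t) + v sin(2 pi t)] and
    [x = sqrt (u^2 + v^2)]; as [f] attains [beta - x] and [beta + x], the bounds
    on [f] say exactly that [0 <= beta - x] and [beta + x <= 1]
    ([trig_amplitude]).

    The block factor.  Attach to every site [i] an independent fair bit [S i].
    Given all the bits, let [X i = 1] with probability
    [beta + x (S (i+1) - S i)], independently over the sites [i].  This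
    probability is one of [beta - x], [beta], [beta + x], hence lies in [0, 1].
    It is realised by giving to the site [i] three further biased coins, one for
    each of the three values; the two bits [S i], [S (i+1)] select the coin that
    decides [X i].  So [X i = h (Y i) (Y (i+1))], where [Y i] is made of four
    independent coins.

    Why it has the right law.  Let [w k] be the probability that [X = 1] at [k]
    prescribed consecutive sites.  Summing over the bits one site at a time is a
    product of 2 by 2 matrices [1/2 [beta, beta + x; beta - x, beta]], whose
    trace is [beta] and whose determinant is [x^2/4]; by Cayley-Hamilton,
    [w (k+2) = beta w (k+1) - x^2/4 w k].  On the other side the Fourier
    coefficients of [f] vanish outside [-1, 0, 1], the one at [0] is [beta] and
    those at [1] and [-1] have product [x^2/4], so the determinants are those of
    tridiagonal matrices and expanding along the first row gives the same
    recursion.  A gap in the set of sites makes both sides factor, so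
    [prob_ones] and [minor_sites] give the same value for every finite set of
    sites.  These events form a pi-system generating the product sigma-algebra,
    which determines the law ([law_unique]).

    Independent coins.  If [(e, r)] splits the uniform law on [0, 1], that is,
    [e] and [r] are independent and [r] is again uniform, then [e], [e o r],
    [e o r o r], ... are independent and identically distributed
    ([draws_independent]).  A biased coin arises by comparing a point with a
    threshold and rescaling the subinterval in which it falls
    ([splits_bernoulli]), and four coins by iterating ([splits_pair]). *)

(** * Preliminaries on measures *)

Lemma measurable_preimage d d' (T : measurableType d) (T' : measurableType d')
    (g : T -> T') (A : set T') :
  measurable_fun setT g -> measurable A -> measurable (g @^-1` A).
Proof. by move=> mg mA; rewrite -[_ @^-1` _]setTI; exact: mg. Qed.

(** Adjoining the whole space to the pi-system [G] turns it into one that covers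
    the space, as the general uniqueness theorem for sigma-finite measures
    requires. *)
Lemma finite_measure_unique d (T : measurableType d) (R : realType)
    (G : set (set T)) (m1 m2 : {measure set T -> \bar R}) :
  (measurable : set (set T)) = <<s G >> -> setI_closed G ->
  (forall A, G A -> m1 A = m2 A) -> m1 setT = m2 setT -> (m1 setT < +oo)%E ->
  forall A, measurable A -> m1 A = m2 A.
Proof.
move=> mG GI m12 mT mfin A mA.
pose G' := G `|` [set setT].
apply: (@measure_unique _ _ _ G' (fun=> setT)) => //.
- rewrite eqEsubset; split.
    rewrite mG; apply: smallest_sub; first exact: smallest_sigma_algebra.
    by move=> B GB; apply: sub_sigma_algebra; left.
  apply: smallest_sub; first exact: sigma_algebra_measurable.
  move=> B [GB|->]; last exact: measurableT.
  by rewrite mG; exact: sub_sigma_algebra.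
- move=> B C [GB|->] [GC|->]; rewrite ?setIT ?setTI.
  + by left; exact: GI.
  + by left.
  + by left.
  + by right.
- by move=> _; right.
- by apply/seteqP; split => // x _; exists 0%N.
- by move=> B [/m12|->].
Qed.

(** * Splitting off independent randomness *)

Section splitting.
Context (R : realType) d (Om : measurableType d) (P : probability Om R).

(** [e] reads a value off a random point and [r] returns a fresh random point:
    taking [A] to be everything shows that [r] preserves [P]. *)
Definition splits d' (E : measurableType d') (e : Om -> E) (r : Om -> Om) :=
  [/\ measurable_fun setT e, measurable_fun setT r &
    forall A C, measurable A -> measurable C ->
      P (e @^-1` A `&` r @^-1` C) = (P (e @^-1` A) * P C)%E].

Lemma splits_pair d' (E : measurableType d') (e1 : Om -> E) (e2 : Om -> bool)
    r1 r2 :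
  splits e1 r1 -> splits e2 r2 ->
  splits (fun x => (e1 x, e2 (r1 x))) (r2 \o r1).
Proof.
move=> [me1 mr1 s1] [me2 mr2 s2].
split; [|exact: measurableT_comp|].
  by apply/measurable_fun_pair => //; exact: measurableT_comp.
move=> A C mA mC.
have mA_ b : measurable (ysection A b) by exact: measurable_ysection.
pose F D b := e1 @^-1` ysection A b `&`
  r1 @^-1` (e2 @^-1` [set b] `&` r2 @^-1` D).
have mF D b : measurable D -> measurable (F D b).
  move=> mD; apply: measurableI; first exact: measurable_preimage.
  apply: measurable_preimage => //.
  by apply: measurableI; exact: measurable_preimage.
(* A measurable subset of E * bool is the union of two rectangles. *)
have split_bool D : measurable D ->
    P ((fun x => (e1 x, e2 (r1 x))) @^-1` A `&` (r2 \o r1) @^-1` D) =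
    (P (e1 @^-1` ysection A true) * (P (e2 @^-1` [set true]) * P D) +
     P (e1 @^-1` ysection A false) * (P (e2 @^-1` [set false]) * P D))%E.
  move=> mD.
  transitivity (P (F D true) + P (F D false))%E; last first.
    by rewrite /F !s1 ?s2 //; apply: measurableI; exact: measurable_preimage.
  rewrite -measureU; [|exact: mF..|].
    congr (P _); apply/seteqP; split=> x /=; rewrite /F /= /ysection /=.
      move=> [Ax Dx]; case: (e2 (r1 x)) Ax => Ax; [left|right];
      by split => //; rewrite inE.
    by move=> [[Ax [e Dx]]|[Ax [e Dx]]];
      rewrite e; split => //; rewrite inE in Ax.
  by apply/seteqP; split => // x [[_ [/= t _]] [_ [/= u _]]]; rewrite t in u.
have := split_bool _ measurableT.
rewrite preimage_setT setIT probability_setT !mule1 => ->.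
rewrite split_bool // muleDl ?fin_num_measure // ?muleA //.
by apply: ge0_adde_def; rewrite inE mule_ge0.
Qed.

Lemma splits_law_pair d' (E : measurableType d') (e1 : Om -> E)
    (e2 : Om -> bool) r1 A b :
  splits e1 r1 -> measurable_fun setT e2 -> measurable A ->
  P [set x | A (e1 x) /\ e2 (r1 x) = b] =
  (P (e1 @^-1` A) * P (e2 @^-1` [set b]))%E.
Proof.
move=> [me1 mr1 s1] me2 mA; rewrite -s1 //.
exact: measurable_preimage.
Qed.

End splitting.

(** * Biased coins from a uniform variable *)

Definition uniform01 (R : realType) : probability (measurableTypeR R) R :=
  uniform_prob (@ltr01 R).

Section uniform.
Context (R : realType).

Local Notation U := (uniform01 R).

Lemma uniform01_lebesgue (A : set R) (i : interval R) :
  measurable A -> A `&` `[0, 1]%classic = [set` i] ->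
  U A = lebesgue_measure ([set` i] : set R).
Proof.
move=> mA Ai; rewrite /uniform01 /= /uniform_prob integral_uniform_pdf Ai.
under eq_integral => x.
  rewrite -Ai inE /= in_itv /= => -[_ x01].
  rewrite /uniform_pdf x01 subr0 invr1.
  over.
by rewrite integral_cst ?mul1e.
Qed.

Lemma uniform01_itv (A : set (measurableTypeR R)) b1 b2 (s t : R) :
  measurable A -> s <= t ->
  (forall x,
     (A x /\ 0 <= x <= 1) <-> x \in Interval (BSide b1 s) (BSide b2 t)) ->
  U A = (t - s)%:E.
Proof.
move=> mA st Ai; pose I := Interval (BSide b1 s) (BSide b2 t).
rewrite (@uniform01_lebesgue _ I) //.
  rewrite lebesgue_measure_itv /= lte_fin; case: ltP => // ts.
  have -> : t = s by apply/eqP; rewrite eq_le ts st.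
  by rewrite subrr.
apply/seteqP; split => x.
  by move=> [Ax /=]; rewrite in_itv/= => x01; apply/Ai.
by move=> /Ai[Ax x01]; split => //=; rewrite in_itv.
Qed.

Lemma uniform01_set0 (A : set (measurableTypeR R)) : measurable A ->
  (forall x, A x -> 0 <= x <= 1 -> False) -> U A = 0%E.
Proof.
move=> mA A0; rewrite (@uniform01_itv A true true 0 0) ?subrr// => x.
rewrite in_itv/=; split => [[Ax /(A0 _ Ax)]//|].
by move=> /andP[a b]; have := le_lt_trans a b; rewrite ltxx.
Qed.

(** The two sides are finite measures of [C], so it is enough to compare them on
    the rays, which form a pi-system. *)
Lemma uniform01_unique (D : set (measurableTypeR R))
    (r : measurableTypeR R -> measurableTypeR R) (w : R) :
  measurable D -> measurable_fun setT r -> 0 <= w ->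
  (forall t, U (D `&` r @^-1` `]t, +oo[%classic) =
             (w%:E * U `]t, +oo[%classic)%E) ->
  U D = w%:E ->
  forall C, measurable C -> U (D `&` r @^-1` C) = (w%:E * U C)%E.
Proof.
move=> mD mr w0 Ut UD C mC.
(* The canonical measure on a pushforward is found up to a proof that r is
   measurable, which m1 takes as its argument. *)
pose m1 : {measure set (measurableTypeR R) -> \bar R} :=
  pushforward (mrestr U mD) r.
pose m2 : {measure set (measurableTypeR R) -> \bar R} := mscale (NngNum w0) U.
have m1E B : m1 mr B = U (D `&` r @^-1` B).
  by rewrite /m1 /= /pushforward /mrestr setIC.
have m2E B : m2 B = (w%:E * U B)%E by [].
rewrite -m1E -m2E.
apply: (@finite_measure_unique _ (measurableTypeR R) R
  (@RGenOInfty.G R) (m1 mr) m2) => //.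
- exact: RGenOInfty.measurableE.
- move=> _ _ [x ->] [y ->]; exists (Num.max x y).
  by apply/seteqP; split => z /=; rewrite !in_itv /= !andbT gt_max => /andP.
- by move=> _ [t ->]; rewrite m1E m2E Ut.
- by rewrite m1E m2E preimage_setT setIT UD probability_setT mule1.
- by rewrite m1E preimage_setT setIT UD ltry.
Qed.

Lemma uniform01_gt (t : R) :
  U `]t, +oo[%classic = (if t < 0 then 1 else if t < 1 then 1 - t else 0)%:E.
Proof.
have m : measurable (`]t, +oo[%classic : set (measurableTypeR R)) by [].
have [t0|t0] := ltP t 0.
  rewrite (@uniform01_itv _ true false 0 1) ?subr0// => x.
  by rewrite /= !in_itv/=; split; lra.
have [t1|t1] := ltP t 1.
  rewrite (@uniform01_itv _ false false t 1)// ?ltW// => x.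
  by rewrite /= !in_itv/=; split; lra.
by rewrite uniform01_set0// => x /=; rewrite in_itv/=; lra.
Qed.

Lemma measurable_below (p : R) :
  measurable_fun setT (fun x : measurableTypeR R => x < p).
Proof. exact: measurable_fun_ltr. Qed.

(** The affine bijections of [[0, p[] and of [[p, 1]] onto the unit interval; if
    [p] is [0] or [1] one of the pieces is negligible. *)
Definition rescale (p : R) (x : measurableTypeR R) : measurableTypeR R :=
  if x < p then x / p else (x - p) / (1 - p).

Lemma measurable_rescale p : measurable_fun setT (rescale p).
Proof.
apply: measurable_fun_ifT; first exact: measurable_below.
  exact: measurable_funM.
by apply: measurable_funM => //; exact: measurable_funB.
Qed.

Lemma measurable_below_eq (p : R) (b : bool) :
  measurable [set x : measurableTypeR R | (x < p) = b].
Proof. exact: (measurable_preimage (measurable_below p) (A := [set b]) I). Qed.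

Lemma uniform01_below (p : R) (b : bool) : 0 <= p <= 1 ->
  U [set x : measurableTypeR R | (x < p) = b] = (if b then p else 1 - p)%:E.
Proof.
move=> p01; case: b.
  transitivity (p - 0)%:E; last by rewrite subr0.
  apply: (@uniform01_itv _ true true) => [||x].
  - exact: measurable_below_eq.
  - by lra.
  - by rewrite in_itv/=; split; [move=> [->]|]; lra.
apply: (@uniform01_itv _ true false) => [||x].
- exact: measurable_below_eq.
- by lra.
rewrite in_itv/=; split; first by move=> [/negbT]; rewrite -leNgt; lra.
by move=> x1; rewrite ltNge; split; [apply/negbTE|]; lra.
Qed.

(** Conditionally on lying on one side of [p], a uniform point is uniform on
    that side. *)
Lemma splits_bernoulli (p : R) : 0 <= p <= 1 ->
  splits U (fun x : measurableTypeR R => x < p) (rescale p).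
Proof.
move=> p01; split; [exact: measurable_below|exact: measurable_rescale|].
have mpre b := measurable_below_eq p b.
have mr t : measurable (rescale p @^-1` `]t, +oo[).
  by apply: measurable_preimage => //; exact: measurable_rescale.
pose w (b : bool) := if b then p else 1 - p.
have w0 b : 0 <= w b by case: b; rewrite /w; lra.
have Uw b : U [set x : measurableTypeR R | (x < p) = b] = (w b)%:E.
  exact: uniform01_below.
have ray b t :
    U ([set x : measurableTypeR R | (x < p) = b] `&`
       rescale p @^-1` `]t, +oo[) =
    ((w b)%:E * U `]t, +oo[%classic)%E.
  rewrite uniform01_gt -EFinM.
  have mI := measurableI _ _ (mpre b) (mr t).
  set S := _ `&` _ in mI *.
  have [wb0|wb_neq0] := eqVneq (w b) 0.
    rewrite wb0 mul0r; apply/eqP; rewrite -measure_le0.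
    rewrite -[leRHS]/(0%:E) -wb0 -Uw; apply: le_measure; rewrite ?inE//.
    exact: subIsetl.
  have wb_gt0 : 0 < w b by rewrite lt_neqAle eq_sym wb_neq0 w0.
  have t0 : t < 0 -> t * w b < 0 by move=> ?; rewrite nmulr_rlt0.
  have t0' : 0 <= t -> 0 <= t * w b by move=> ?; rewrite mulr_ge0// ltW.
  have t1 : t < 1 -> t * w b < w b by move=> ?; rewrite gtr_pMl.
  have t1' : 1 <= t -> w b <= t * w b by move=> ?; rewrite ler_peMl// ltW.
  case: b @S mI wb_neq0 wb_gt0 t0 t0' t1 t1' => S mI;
    rewrite /w => wb_neq0 wb_gt0 t0 t0' t1 t1'.
  - have SE x : S x <-> (x < p) && (t * p < x).
      rewrite /S /= /rescale in_itv/= andbT; split=> [[xp]|/andP[xp]].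
        by rewrite xp ltr_pdivlMr.
      by rewrite xp ltr_pdivlMr.
    have [tn|tn] := ltP t 0; last have [tl1|tl1] := ltP t 1.
    + transitivity (p - 0)%:E; last by congr EFin; ring.
      have t0n := t0 tn.
      apply: (@uniform01_itv _ true true) => [||x]; [exact: mI|lra|].
      by rewrite in_itv/=; split=> [[/SE ? ?]|?]; [lra|split; [apply/SE|]; lra].
    + transitivity (p - t * p)%:E; last by congr EFin; ring.
      have t0n := t0' tn; have t1n := t1 tl1.
      apply: (@uniform01_itv _ false true) => [||x]; [exact: mI|lra|].
      by rewrite in_itv/=; split=> [[/SE ? ?]|?]; [lra|split; [apply/SE|]; lra].
    + have t1n := t1' tl1.
      by rewrite mulr0 uniform01_set0// => x /SE; lra.
  - have SE x : S x <-> (p <= x) && (t * (1 - p) < x - p).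
      rewrite /S /= /rescale in_itv/= andbT; split=> [[xp]|/andP[xp]].
        by rewrite xp leNgt xp ltr_pdivlMr.
      have -> : (x < p) = false by apply/negbTE; rewrite -leNgt.
      by rewrite ltr_pdivlMr.
    have [tn|tn] := ltP t 0; last have [tl1|tl1] := ltP t 1.
    + transitivity (1 - p)%:E; last by congr EFin; ring.
      have t0n := t0 tn.
      apply: (@uniform01_itv _ true false) => [||x]; [exact: mI|lra|].
      by rewrite in_itv/=; split=> [[/SE ? ?]|?]; [lra|split; [apply/SE|]; lra].
    + transitivity (1 - (t * (1 - p) + p))%:E; last by congr EFin; ring.
      have t0n := t0' tn; have t1n := t1 tl1.
      apply: (@uniform01_itv _ false false) => [||x]; [exact: mI|lra|].
      by rewrite in_itv/=; split=> [[/SE ? ?]|?]; [lra|split; [apply/SE|]; lra].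
    + have t1n := t1' tl1.
      by rewrite mulr0 uniform01_set0// => x /SE; lra.
have key b C : measurable C ->
    U ([set x : measurableTypeR R | (x < p) = b] `&` rescale p @^-1` C) =
    ((w b)%:E * U C)%E.
  move=> mC; apply: uniform01_unique => //.
  exact: measurable_rescale.
move=> A C mA mC.
have mCr : measurable (rescale p @^-1` C).
  by apply: measurable_preimage => //; exact: measurable_rescale.
have [| | |] := set_bool A => /eqP ->.
- by rewrite key// -Uw.
- by rewrite key// -Uw.
- by rewrite preimage_set0 set0I measure0 mul0e.
- rewrite preimage_setT setTI probability_setT mul1e.
  pose S b := [set x : measurableTypeR R | (x < p) = b] `&` rescale p @^-1` C.
  transitivity (U (S true) + U (S false))%E; last first.
    rewrite !key// -ge0_muleDl ?lee_fin ?w0//.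
    by rewrite -EFinD addrC subrK mul1e.
  have mS b : measurable (S b) by exact: measurableI.
  rewrite -measureU//.
  + congr (U _); apply/seteqP; split=> x; last by move=> [[]|[]].
    by rewrite /S /=; case: (x < p); [left|right].
  + by apply/seteqP; split=> // x [[/= xt _] [/= xf _]]; rewrite xt in xf.
Qed.
End uniform.

(** * Independent draws *)

Section iid.
Context (R : realType) d (Om : measurableType d) (P : probability Om R).
Context d' (E : measurableType d') (e : Om -> E) (r : Om -> Om).
Hypothesis er : splits P e r.

Let mr : measurable_fun setT r. Proof. by have [] := er. Qed.
Let me : measurable_fun setT e. Proof. by have [] := er. Qed.

Lemma measurable_iter n : measurable_fun setT (fun x => iter n r x).
Proof. by elim: n => [|n IH] //=; exact: measurableT_comp. Qed.

Definition draw n : Om -> E := fun x => e (iter n r x).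

Lemma measurable_draw n : measurable_fun setT (draw n).
Proof. by apply: measurableT_comp; [exact: me|exact: measurable_iter]. Qed.

Lemma draw_law n A : measurable A -> P (draw n @^-1` A) = P (e @^-1` A).
Proof.
move=> mA; elim: n => // n IH.
have [_ _ s] := er.
have mD : measurable (draw n @^-1` A).
  by apply: measurable_preimage => //; exact: measurable_draw.
have := s setT _ measurableT mD.
rewrite preimage_setT setTI probability_setT mul1e IH => <-; congr (P _).
by apply/seteqP; split=> x; rewrite /draw /= -iterSr.
Qed.

(** The draws after the first one are the draws from the fresh point [r x],
    which is independent of the first one and has the same law as [x]. *)
Lemma draws_independent N (A : nat -> set E) : (forall n, measurable (A n)) ->
  P [set x | forall n, (n < N)%N -> A n (draw n x)] =
  (\prod_(n < N) P (e @^-1` A n))%E.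
Proof.
elim: N A => [|N IH] A mA.
  rewrite big_ord0 -[RHS](probability_setT P); congr (P _).
  by apply/seteqP; split.
have [_ _ s] := er.
have mD : measurable [set x | forall n, (n < N)%N -> A n.+1 (draw n x)].
  rewrite [X in measurable X](_ : _ = \bigcap_(n < N) draw n @^-1` A n.+1) //.
  apply: bigcap_measurableType => n _.
  by apply: measurable_preimage => //; exact: measurable_draw.
transitivity (P (e @^-1` A 0%N) *
    P [set x | forall n, (n < N)%N -> A n.+1 (draw n x)])%E; last first.
  rewrite big_ord_recl (IH (A \o S)) // => n; exact: mA.
rewrite -s //; congr (P _); apply/seteqP; split=> x /=.
  move=> Ax; split; first exact: (Ax 0%N).
  by move=> n nN; have := Ax n.+1 nN; rewrite /draw iterSr.
by move=> [A0 AS] [//|n] nN; rewrite /draw iterSr; exact: AS.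
Qed.

Lemma prod_iota_pickle (J : {fset int}) N (F : nat -> \bar R) :
  (forall j, j \in J -> (choice.pickle j < N)%N) ->
  (forall n, n \notin map choice.pickle J -> F n = 1%E) ->
  (\prod_(n < N) F n = \prod_(j <- J) F (choice.pickle j))%E.
Proof.
move=> JN F1; rewrite -(big_mkord xpredT F) /= /index_iota subn0.
rewrite (bigID (mem (map choice.pickle J))) /=.
rewrite [X in (_ * X)%E]big1 ?mule1; last exact: F1.
rewrite -big_filter -[RHS](big_map choice.pickle xpredT F); apply: perm_big.
apply: uniq_perm.
- by rewrite filter_uniq// iota_uniq.
- by rewrite map_inj_uniq ?fset_uniq//; exact: (pcan_inj choice.pickleK).
- move=> n; rewrite mem_filter mem_iota /= add0n.
  by apply: andb_idr => /mapP[j /JN jN ->].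
Qed.

(** The draws are indexed by natural numbers; an enumeration of the integers
    turns them into a process on the integers. *)
Definition splits_process (i : int) : {RV P >-> E} :=
  mfun_Sub (mem_set (measurable_draw (choice.pickle i))).

Lemma splits_process_iid : iid_process splits_process.
Proof.
split; last first.
  by move=> i j A mA; rewrite !draw_law.
move=> J A mA.
have pickle_invE n (j : int) :
    choice.pickle_inv n = Some j -> choice.pickle j = n.
  by move=> nj; have := @choice.pickle_invK int n; rewrite nj.
(* The index n that codes no element of J gets the trivial constraint setT. *)
pose A' n := if choice.pickle_inv n is Some j then
  (if j \in J then A j else setT) else setT.
have mA' n : measurable (A' n).
  by rewrite /A'; case: choice.pickle_inv => // j; case: ifP.
pose N := (\max_(j <- J) choice.pickle j).+1.
have JN j : j \in J -> (choice.pickle j < N)%N.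
  by move=> jJ; rewrite /N ltnS; exact: leq_bigmax_seq.
have A'J j : j \in J -> A' (choice.pickle j) = A j.
  by move=> jJ; rewrite /A' choice.pickleK_inv jJ.
transitivity (P [set x | forall n, (n < N)%N -> A' n (draw n x)]).
  congr (P _); apply/seteqP; split=> x /=.
    move=> Ax n nN; rewrite /A'; case E' : choice.pickle_inv => [j|//].
    case: ifP => // jJ; have := Ax j jJ => /=.
    by rewrite /= (pickle_invE _ _ E').
  by move=> Ax j /= jJ; have := Ax _ (JN _ jJ); rewrite A'J.
rewrite draws_independent //.
rewrite (prod_iota_pickle (F := fun n => P (e @^-1` A' n)) JN).
  apply: eq_big_seq => j jJ.
  by rewrite A'J// draw_law.
move=> n nJ; rewrite /A'; case E' : choice.pickle_inv => [j|]; last first.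
  by rewrite preimage_setT probability_setT.
case: ifP => jJ; last by rewrite preimage_setT probability_setT.
by move: nJ; rewrite -(pickle_invE _ _ E') map_f.
Qed.
End iid.

(** * The two-block factor and its transfer recursion *)

Section transfer.
(* H beta gamma is the probability of a one between spins beta and gamma. *)
Context (R : realType) (H : bool -> bool -> R).

(** Probability of ones at the sites marked by [s], given the spin [beta] at the
    first site: a product of transfer matrices, with the next spin [gamma]
    summed out at every step. *)
Fixpoint transfer (s : seq bool) (beta : bool) : R :=
  if s is b :: s' then
    \sum_(gamma : bool) (if b then H beta gamma else 1) / 2 * transfer s' gamma
  else 1.

Context d (Om : measurableType d) (P : probability Om R).
Context d' (E : measurableType d') (Y : int -> {RV P >-> E}).
Hypothesis Y_indep : independent_process P Y.
Variables (B : E -> bool) (V : bool -> bool -> E -> bool).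
Hypothesis mB : measurable_fun setT B.
Hypothesis mV : forall beta gamma, measurable_fun setT (V beta gamma).
Hypothesis B_law : forall i beta,
  P (Y i @^-1` [set y | B y = beta]) = (1 / 2)%:E.
Hypothesis V_law : forall i beta gamma,
  P (Y i @^-1` [set y | B y = beta /\ V beta gamma y = true]) =
  (H beta gamma / 2)%:E.

Let mpre i A : measurable A -> measurable (Y i @^-1` A).
Proof. by apply: measurable_preimage; exact: measurable_funPT. Qed.

(** [F] is independent of the variables from [m] on.  This is the form of
    independence that is inherited when the variables are revealed from left to
    right ([past_step]). *)
Definition past (m : int) (F : set Om) := measurable F /\
  forall N (A : nat -> set E), (forall n, measurable (A n)) ->
  P (F `&` [set w | forall n, (n < N)%N -> A n (Y (m + n%:Z) w)]) =
  (P F * \prod_(n < N) P (Y (m + n%:Z) @^-1` A n))%E.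

Lemma past_setT m : past m setT.
Proof.
split=> // N A mA; rewrite setTI probability_setT mul1e.
pose s := [seq m + n%:Z | n <- iota 0 N].
have us : uniq s.
  by rewrite map_inj_uniq ?iota_uniq// => i j /addrI [].
have [J JE Js] : exists2 J : {fset int}, J =i s & perm_eq J s.
  exists (seq_fset tt s); first exact: seq_fsetE.
  by apply: perm_trans (seq_fset_perm tt s) _; rewrite undup_id.
transitivity (P (\bigcap_(j in [set` J]) (Y j @^-1` A `|(j - m)%R|%N))).
  congr (P _); apply/seteqP; split=> w /=.
    move=> Aw j /=; rewrite JE => /mapP[n]; rewrite mem_iota add0n /= => nN ->.
    by rewrite addrAC subrr add0r absz_nat; exact: Aw.
  move=> Aw n nN; have := Aw (m + n%:Z).
  rewrite /= JE addrAC subrr add0r absz_nat; apply.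
  by apply: map_f; rewrite mem_iota.
rewrite Y_indep; last by move=> j; exact: mA.
rewrite (perm_big _ Js) /= big_map -{1}(subn0 N) -/(index_iota 0 N) big_mkord.
apply: eq_bigr => n _.
by rewrite addrAC subrr add0r absz_nat.
Qed.

Lemma past1 m F A : past m F -> measurable A ->
  P (F `&` Y m @^-1` A) = (P F * P (Y m @^-1` A))%E.
Proof.
move=> [mF pF] mA; have := pF 1%N (fun=> A) (fun=> mA).
rewrite big_ord1 addr0 => <-; congr (P (_ `&` _)).
apply/seteqP; split=> w /=; last by move=> /(_ 0%N isT); rewrite addr0.
by move=> Aw [|n]//; rewrite addr0.
Qed.

Lemma past_step m F A : past m F -> measurable A ->
  past (m + 1) (F `&` Y m @^-1` A).
Proof.
move=> pmF mA; have [mF pF] := pmF.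
split; first by apply: measurableI => //; exact: mpre.
move=> N C mC; rewrite past1// -muleA.
pose A' n := if n is n'.+1 then C n' else A.
have mA' n : measurable (A' n) by case: n.
have := pF N.+1 A' mA'; rewrite big_ord_recl /= addr0.
have mS (n : nat) : m + 1 + n%:Z = m + n.+1%:Z by rewrite -addrA -PoszD add1n.
under [in X in _ -> _ = X]eq_bigr => n _ do rewrite mS.
move=> <-; congr (P _); apply/seteqP; split=> w /=.
  move=> [[Fw Aw] Cw]; split => // -[_|n nN]; first by rewrite addr0.
  by rewrite -mS; exact: Cw.
move=> [Fw Aw]; split; first by split=> //; have := Aw 0%N isT; rewrite addr0.
by move=> n nN; rewrite mS; exact: (Aw n.+1).
Qed.

Definition factor (i : int) (w : Om) : bool :=
  V (B (Y i w)) (B (Y (i + 1) w)) (Y i w).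

Fixpoint ones (m : int) (s : seq bool) : set Om :=
  if s is b :: s' then [set w | b -> factor m w] `&` ones (m + 1) s' else setT.

Lemma measurable_factor i : measurable_fun setT (factor i).
Proof.
have mBY j : measurable_fun setT (fun w => B (Y j w)).
  by apply: measurableT_comp; [exact: mB|exact: measurable_funPT].
have mVY b c : measurable_fun setT (fun w => V b c (Y i w)).
  by apply: measurableT_comp; [exact: mV|exact: measurable_funPT].
rewrite [X in measurable_fun _ X](_ : _ = fun w => if B (Y i w)
    then (if B (Y (i + 1) w) then V true true (Y i w)
          else V true false (Y i w))
    else (if B (Y (i + 1) w) then V false true (Y i w)
          else V false false (Y i w))).
  by do ![apply: measurable_fun_ifT => //].
by apply/funext => w; rewrite /factor; case: B; case: B.
Qed.

Lemma measurable_ones m s : measurable (ones m s).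
Proof.
elim: s m => //= b s IH m; apply: measurableI => //.
case: b; last by rewrite (_ : [set _ | _] = setT)//; apply/seteqP; split.
rewrite (_ : [set _ | _] = factor m @^-1` [set true]).
  exact: (measurable_preimage (measurable_factor m) (A := [set true]) I).
by apply/seteqP; split=> w /=; [exact|move=> ->].
Qed.

(** Induction on the pattern: the event is cut according to the spin [c] at
    [m + 1], and what is known about [Y m] is absorbed into the past. *)
Lemma prob_ones_from m F s beta : past m F ->
  P (F `&` [set w | B (Y m w) = beta] `&` ones m s) =
  (P F * (transfer s beta / 2)%:E)%E.
Proof.
have mBset b : measurable [set y | B y = b].
  exact: (measurable_preimage mB (A := [set b]) I).
elim: s m F beta => [|b s IH] m F beta pF.
  by rewrite /= setIT -(B_law m beta) -past1.
pose A c := [set y | B y = beta /\ (b -> V beta c y)].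
have mA c : measurable (A c).
  rewrite (_ : A c = [set y | B y = beta] `&`
                     (if b then [set y | V beta c y = true] else setT)).
    apply: measurableI => //; case: (b) => //.
    exact: (measurable_preimage (mV beta c) (A := [set true]) I).
  rewrite /A; apply/seteqP; split=> y /= -[By Vy]; split=> //.
      by case: (b) Vy => //= /(_ isT).
    by case: (b) Vy => //= ->.
have PA c : P (Y m @^-1` A c) = ((if b then H beta c else 1) / 2)%:E.
  rewrite /A; case: b @A mA => A mA;
    rewrite -?(V_law m) -?(B_law m beta); congr (P _).
    by apply/seteqP; split=> w [? /= Vy]; split=> //; exact: Vy.
  by apply/seteqP; split=> w //= -[].
pose S c := F `&` Y m @^-1` A c `&` [set w | B (Y (m + 1) w) = c] `&`
  ones (m + 1) s.
have mS c : measurable (S c).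
  apply: measurableI; last exact: measurable_ones.
  apply: measurableI; last exact: (@mpre (m + 1) _ (mBset c)).
  by apply: measurableI; [case: pF|exact: mpre].
have PS c : P (S c) =
    (P F * ((if b then H beta c else 1) / 2 * (transfer s c / 2))%:E)%E.
  by rewrite /S IH ?past1// ?PA -?muleA -?EFinM//; exact: past_step.
transitivity (P (S true) + P (S false))%E.
  rewrite -measureU//.
    congr (P _); apply/seteqP; split=> w; rewrite /S /A /=.
      move=> [[Fw Bw] [Vw Ow]]; rewrite /factor Bw in Vw.
      by case: (B (Y (m + 1) w)) Vw => Vw; [left|right].
    by move=> [|] [[[Fw [Bw Vw]] Bw1] Ow]; do !split => //;
      rewrite /factor Bw Bw1.
  apply/seteqP; split => // w [[[_ /= wt] _] [[_ /= wf] _]].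
  by rewrite wt in wf.
rewrite !PS -muleDr ?fin_num_measure //; last by case: pF.
by congr (_ * _)%E; rewrite -EFinD; congr EFin; rewrite /= big_bool /=; ring.
Qed.

Lemma prob_ones m s :
  P (ones m s) = ((transfer s true + transfer s false) / 2)%:E.
Proof.
pose S c := [set w | B (Y m w) = c] `&` ones m s.
have mS c : measurable (S c).
  apply: measurableI; last exact: measurable_ones.
  apply: (@mpre m [set y | B y = c]).
  exact: (measurable_preimage mB (A := [set c]) I).
transitivity (P (S true) + P (S false))%E.
  rewrite -measureU//.
    congr (P _); apply/seteqP; split=> w; rewrite /S /=; last by move=> [|] [].
    by move=> Ow; case: (B (Y m w)); [left|right].
  by apply/seteqP; split => // w [[/= wt _] [/= wf _]]; rewrite wt in wf.
have PS c : P (S c) = (transfer s c / 2)%:E.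
  rewrite /S -[X in P (X `&` _)]setTI prob_ones_from; last exact: past_setT.
  by rewrite probability_setT mul1e.
by rewrite !PS -EFinD; congr EFin; rewrite mulrDl.
Qed.

End transfer.

Section success.
Variables (R : realType) (b x : R).

Definition success (beta gamma : bool) : R := b + x * (gamma%:R - beta%:R).

Definition prob_pattern (s : seq bool) : R :=
  (transfer success s true + transfer success s false) / 2.

Lemma prob_pattern_nil : prob_pattern [::] = 1.
Proof. by rewrite /prob_pattern /=; field. Qed.

Lemma prob_pattern_false s : prob_pattern (false :: s) = prob_pattern s.
Proof. by rewrite /prob_pattern /= !big_bool /=; field. Qed.

(** If the next site carries no condition, what remains of the pattern does not
    depend on the spin there, and averaging [success beta gamma] over both spins
    leaves [b]. *)
Lemma prob_pattern_true_far s : (if s is c :: _ then ~~ c else true) ->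
  prob_pattern (true :: s) = b * prob_pattern s.
Proof.
rewrite /prob_pattern /success; case: s => [_|[]// s _].
  by rewrite /= !big_bool /=; field.
by rewrite /= !big_bool /=; field.
Qed.

(** Cayley-Hamilton for the transfer matrix. *)
Lemma prob_pattern_true_true s :
  prob_pattern [:: true, true & s] =
  b * prob_pattern (true :: s) - x ^+ 2 / 4 * prob_pattern s.
Proof. by rewrite /prob_pattern /success /= !big_bool /=; field. Qed.

End success.

(** * Minors of tridiagonal Toeplitz matrices *)

Section toeplitz_minors.
Variables (C : comNzRingType) (t : int -> C).
Hypothesis t0 : forall k : int, 1 < `|k| -> t k = 0.

Definition minor (l : seq int) : C :=
  \det (\matrix_(i < size l, j < size l) t (l`_j - l`_i)).

Lemma minor_nil : minor [::] = 1.
Proof. by rewrite /minor det_mx00. Qed.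

Lemma nth_far (m : int) (l : seq int) (j : 'I_(size l)) :
  (forall y, y \in l -> m + 2 <= y) -> 1 < l`_j - m.
Proof.
move=> ml; have : m + 2 <= l`_j by apply: ml; exact: mem_nth.
by lia.
Qed.

Lemma minor_cons_far (m : int) (l : seq int) :
  (forall y, y \in l -> m + 2 <= y) ->
  minor (m :: l) = t 0 * minor l.
Proof.
move=> ml; rewrite /minor (expand_det_row _ ord0) big_ord_recl big1.
  rewrite addr0 mxE /= subrr; congr (_ * _).
  rewrite /cofactor expr0 mul1r; congr (\det _).
  by apply/matrixP => i j; rewrite !mxE.
move=> j _; rewrite mxE /= t0 ?mul0r//.
by apply: lt_le_trans (ler_norm _); exact: (nth_far j ml).
Qed.

(** The first row has two nonzero entries, and the first column of the cofactor
    of the second one has a single nonzero entry. *)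
Lemma minor_cons_near (m : int) (l : seq int) :
  (forall y, y \in l -> m + 2 <= y) ->
  minor [:: m, m + 1 & l] = t 0 * minor (m + 1 :: l) - t 1 * t (-1) * minor l.
Proof.
move=> ml.
rewrite {1}/minor (expand_det_row _ ord0) !big_ord_recl big1; last first.
  move=> j _; rewrite mxE /= t0 ?mul0r//.
  by apply: lt_le_trans (ler_norm _); exact: (nth_far j ml).
rewrite addr0 !mxE /= subrr [m + 1 - m]addrAC subrr add0r; congr (_ + _).
  congr (_ * _); rewrite /cofactor expr0 mul1r; congr (\det _).
  by apply/matrixP => i j; rewrite !mxE.
rewrite /cofactor /= expr1 mulN1r mulrN -mulrA; congr (- (_ * _)).
rewrite (expand_det_col _ ord0) big_ord_recl big1; last first.
  move=> j _; rewrite !mxE /= t0 ?mul0r// distrC.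
  by apply: lt_le_trans (ler_norm _); exact: (nth_far j ml).
rewrite addr0 !mxE /=; congr (t _ * _); first lia.
rewrite /cofactor expr0 mul1r; congr (\det _).
by apply/matrixP => i j; rewrite !mxE.
Qed.

End toeplitz_minors.

(** * Equality of the two recursions *)

Fixpoint sites (m : int) (s : seq bool) : seq int :=
  if s is b :: s' then
    if b then m :: sites (m + 1) s' else sites (m + 1) s'
  else [::].

Lemma sites_ge m s y : y \in sites m s -> m <= y.
Proof.
elim: s m => //= -[] s IH m; last by move=> /IH; lia.
by rewrite in_cons => /orP[/eqP ->//|/IH]; lia.
Qed.

Lemma sites_uniq m s : uniq (sites m s).
Proof.
elim: s m => //= -[] s IH m //=; rewrite IH andbT.
by apply/negP => /sites_ge; lia.
Qed.

(** Inside a run of consecutive sites both sides obey the same recursion of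
    order two, and both factor at the end of a run. *)
Lemma minor_sites (R : realType) (t : int -> R[i]) (b x : R) m s :
  (forall k : int, 1 < `|k| -> t k = 0) ->
  t 0 = b%:C%C -> t 1 * t (-1) = (x ^+ 2 / 4)%:C%C ->
  minor t (sites m s) = (prob_pattern b x s)%:C%C.
Proof.
move=> t0 tb tx.
(* The recursion has depth two, hence an induction on the length. *)
elim: {s}(size s) {-2}s (leqnn (size s)) m => [|n IH] s.
  by rewrite leqn0 size_eq0 => /eqP -> m; rewrite minor_nil prob_pattern_nil.
case: s => [_ m|[] s sn m]; first by rewrite minor_nil prob_pattern_nil.
  case: s sn => [|[] s] sn.
  - rewrite minor_cons_far// minor_nil prob_pattern_true_far// prob_pattern_nil.
    by rewrite tb !mulr1.
  - rewrite /= minor_cons_near//; last first.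
      by move=> y /sites_ge; lia.
    rewrite tb tx (IH (true :: s) sn (m + 1)) (IH s (ltnW sn)).
    by rewrite prob_pattern_true_true rmorphB !rmorphM.
  - rewrite [sites _ _]/= minor_cons_far//; last by move=> y /sites_ge; lia.
    rewrite tb (IH (false :: s) sn (m + 1)).
    by rewrite prob_pattern_true_far//; exact/esym/rmorphM.
by rewrite /= prob_pattern_false IH.
Qed.

(** * Fourier coefficients of a trigonometric polynomial of degree one *)

Section trigonometric_integrals.
Variable R : realType.
Implicit Types (n k : int) (x a b : R).

Lemma cos_2pi_int n : cos (2 * pi * n%:~R : R) = 1.
Proof.
suff nat_case (m : nat) : cos (2 * pi * m%:R : R) = 1.
  by case: n => m; rewrite ?NegzE ?rmorphN/= ?mulrN ?cosN -?pmulrn nat_case.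
rewrite -[_ * _]add0r (_ : 2 * pi * m%:R = pi *+ 2 *+ m).
  by rewrite periodicn ?cos0//; exact: cosD2pi.
by rewrite -[RHS]mulr_natr mulr2n; ring.
Qed.

Lemma sin_2pi_int n : sin (2 * pi * n%:~R : R) = 0.
Proof.
have := cos2Dsin2 (2 * pi * n%:~R : R); rewrite cos_2pi_int expr1n.
by move=> /(canRL (addKr _)); rewrite addNr => /eqP; rewrite sqrf_eq0 => /eqP.
Qed.

Definition harmonic n a b x : R :=
  a * cos (2 * pi * n%:~R * x) + b * sin (2 * pi * n%:~R * x).

Lemma is_derive_2piM n x :
  is_derive x 1 (fun y => 2 * pi * n%:~R * y) (2 * pi * n%:~R : R).
Proof. by apply: is_derive_eq; rewrite /GRing.scale/= mulr1. Qed.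

Lemma is_derive_primitive n a b x : n != 0 ->
  is_derive x 1 (fun x => (a * sin (2 * pi * n%:~R * x) -
    b * cos (2 * pi * n%:~R * x)) / (2 * pi * n%:~R)) (harmonic n a b x).
Proof.
move=> n0; have n0' : n%:~R != 0 :> R by rewrite intr_eq0.
have pi0 : pi != 0 :> R by rewrite gt_eqF// pi_gt0.
have lin := is_derive_2piM n x.
apply: is_derive_eq.
rewrite /harmonic /GRing.scale /=; move: (pi : R) pi0 => w w0.
by field; rewrite n0' w0.
Qed.

Lemma continuous_harmonic n a b : continuous (harmonic n a b).
Proof.
move=> x; apply/differentiable_continuous/derivable1_diffP.
have lin := is_derive_2piM n x.
by apply: ex_derive; rewrite /harmonic; typeclasses eauto.
Qed.

Lemma integrable_harmonic n a b :
  lebesgue_measure.-integrable `[0, 1]%classic (EFin \o harmonic n a b).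
Proof.
apply: continuous_compact_integrable; first exact: segment_compact.
by apply: continuous_subspaceT; exact: continuous_harmonic.
Qed.

Lemma Rintegral_harmonic n a b :
  \int[lebesgue_measure]_(x in `[0, 1]%classic) harmonic n a b x =
  a * (n == 0)%:R.
Proof.
have [->|n0] := eqVneq n 0.
  transitivity (\int[@lebesgue_measure R]_(x in `[0, 1]%classic) a).
    apply: eq_Rintegral => x _.
    by rewrite /harmonic mulr0 mul0r cos0 sin0 mulr0 mulr1 addr0.
  rewrite Rintegral_cst//; have := @lebesgue_measure_itv R `[0, 1].
  rewrite /= lte_fin ltr01 oppr0 adde0 => mE.
  by congr (_ * _); transitivity (fine (1%:E : \bar R)); [congr fine|].
rewrite mulr0 /Rintegral.
set F := fun x : R => (a * sin (2 * pi * n%:~R * x) -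
    b * cos (2 * pi * n%:~R * x)) / (2 * pi * n%:~R).
have dF x : is_derive x 1 F (harmonic n a b x) by exact: is_derive_primitive.
have cF : continuous F.
  move=> x; apply/differentiable_continuous/derivable1_diffP.
  exact: ex_derive.
rewrite (@continuous_FTC2 _ _ F) ?ltr01//.
- by rewrite /F !mulr1 !mulr0 cos_2pi_int sin_2pi_int cos0 sin0 -EFinB subrr.
- by apply: continuous_subspaceT; exact: continuous_harmonic.
- split; first by move=> x _; exact: ex_derive.
    by apply: cvg_at_right_filter; exact: cF.
  by apply: cvg_at_left_filter; exact: cF.
- by move=> x _; rewrite derive1E; exact: derive_val.
Qed.

Lemma Rintegral_harmonic3 n1 a1 b1 n2 a2 b2 n3 a3 b3 :
  \int[lebesgue_measure]_(x in `[0, 1]%classic)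
    (harmonic n1 a1 b1 x + harmonic n2 a2 b2 x + harmonic n3 a3 b3 x) =
  a1 * (n1 == 0)%:R + a2 * (n2 == 0)%:R + a3 * (n3 == 0)%:R.
Proof.
rewrite RintegralD//; last exact: integrable_harmonic.
  by rewrite RintegralD ?Rintegral_harmonic//; exact: integrable_harmonic.
exact: (integrableD _ (integrable_harmonic n1 a1 b1)
                      (integrable_harmonic n2 a2 b2)).
Qed.

(** By the product-to-sum formulas the integrand is a sum of harmonics of
    frequencies [k], [k + 1] and [k - 1]. *)
Lemma fourier_coef_trig (f : R -> R) (beta u v : R) k :
  (forall x, x \in `[0, 1] ->
     f x = beta + u * cos (2 * pi * x) + v * sin (2 * pi * x)) ->
  fourier_coef f k =
  (beta * (k == 0)%:R + u / 2 * (k + 1 == 0)%:R + u / 2 * (k - 1 == 0)%:R) +i*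
  (v / 2 * (k + 1 == 0)%:R - v / 2 * (k - 1 == 0)%:R).
Proof.
move=> fE; rewrite /fourier_coef /complex_integral; congr (_ +i* _).
  rewrite -(Rintegral_harmonic3 k beta 0 (k + 1) (u / 2) (v / 2)
                                (k - 1) (u / 2) (- (v / 2))).
  apply: eq_Rintegral => x; rewrite inE => x01.
  rewrite /expi /= fE// mul0r subr0 cosN /harmonic !rmorphD/= rmorphN/= rmorph1.
  set K : R := k%:~R.
  rewrite (_ : 2 * pi * (K + 1) * x = 2 * pi * K * x + 2 * pi * x); last ring.
  rewrite (_ : 2 * pi * (K - 1) * x = 2 * pi * K * x - 2 * pi * x); last ring.
  by rewrite cosD sinD cosB sinB; field.
have -> : v / 2 * (k + 1 == 0)%:R - v / 2 * (k - 1 == 0)%:R =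
    0 * (k == 0)%:R + v / 2 * (k + 1 == 0)%:R + - (v / 2) * (k - 1 == 0)%:R.
  by ring.
rewrite -(Rintegral_harmonic3 k 0 (- beta) (k + 1) (v / 2) (- (u / 2))
                              (k - 1) (- (v / 2)) (- (u / 2))).
apply: eq_Rintegral => x; rewrite inE => x01.
rewrite /expi /= fE// mul0r addr0 sinN /harmonic !rmorphD/= rmorphN/= rmorph1.
set K : R := k%:~R.
rewrite (_ : 2 * pi * (K + 1) * x = 2 * pi * K * x + 2 * pi * x); last ring.
rewrite (_ : 2 * pi * (K - 1) * x = 2 * pi * K * x - 2 * pi * x); last ring.
by rewrite cosD sinD cosB sinB; field.
Qed.

Lemma circle_angle (p q : R) : p ^+ 2 + q ^+ 2 = 1 ->
  exists x, [/\ 0 <= x <= 1, cos (2 * pi * x) = p & sin (2 * pi * x) = q].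
Proof.
move=> pq1.
have p1 : -1 <= p <= 1 by apply/andP; split; nra.
have pi_gt := @pi_gt0 R.
pose y := acos p / (2 * pi).
have yE : 2 * pi * y = acos p by rewrite /y mulrC divfK// mulf_neq0// gt_eqF.
have y0 : 0 <= y <= 2^-1.
  rewrite /y divr_ge0 ?acos_ge0//=; last lra.
  by rewrite ler_pdivrMr; [have := acos_lepi p1; lra|lra].
have cosy : cos (2 * pi * y) = p by rewrite yE acosK// in_itv.
have siny : sin (2 * pi * y) = `|q|.
  by rewrite yE sin_acos// (_ : 1 - p ^+ 2 = q ^+ 2) ?sqrtr_sqr//; lra.
have [q0|q0] := leP 0 q.
  by exists y; split; [lra|done|rewrite siny ger0_norm].
exists (1 - y); split; first lra.
all: rewrite (_ : 2 * pi * (1 - y) = - (2 * pi * y) + pi *+ 2);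
  last by rewrite mulr2n; ring.
  by rewrite cosD2pi cosN.
by rewrite sinD2pi sinN siny ltr0_norm// opprK.
Qed.

(** [f] attains [beta + x] and [beta - x] at the angles of the unit vectors
    [(u, v) / x] and [- (u, v) / x]; it is constant if [x = 0]. *)
Lemma trig_amplitude (f : R -> R) (beta u v : R) :
  (forall x, x \in `[0, 1] ->
     f x = beta + u * cos (2 * pi * x) + v * sin (2 * pi * x)) ->
  (forall x, x \in `[0, 1] -> 0 <= f x <= 1) ->
  let x := Num.sqrt (u ^+ 2 + v ^+ 2) in 0 <= beta - x /\ beta + x <= 1.
Proof.
move=> fE f01 x.
have x2 : x ^+ 2 = u ^+ 2 + v ^+ 2 by rewrite sqr_sqrtr// addr_ge0// sqr_ge0.
have x0 : 0 <= x by exact: sqrtr_ge0.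
have attained (s : R) : s ^+ 2 = 1 -> 0 <= beta + s * x <= 1.
  move=> s1; have [x00|xn0] := eqVneq x 0.
    have u0 : u = 0 by move: x2; rewrite x00; nra.
    have v0 : v = 0 by move: x2; rewrite x00; nra.
    have z01 : (0 : R) \in `[0, 1] by rewrite in_itv /= lexx ler01.
    by have := f01 0 z01; rewrite fE// u0 v0 x00 !mul0r mulr0 !addr0.
  have [|y [y01 cy sy]] := @circle_angle (s * u / x) (s * v / x).
    rewrite !exprMn s1 !mul1r -mulrDl -x2 exprVn divff// sqrf_eq0//.
  have yI : y \in `[0, 1] by rewrite in_itv.
  have := f01 y yI; rewrite fE// cy sy.
  rewrite (_ : beta + u * (s * u / x) + v * (s * v / x) = beta + s * x)//.
  rewrite -addrA; congr (_ + _).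
  transitivity (s * (u ^+ 2 + v ^+ 2) / x); first by ring.
  by rewrite -x2; field.
have := attained 1; rewrite expr1n => /(_ erefl).
have := attained (-1); rewrite sqrrN expr1n => /(_ erefl).
by split; lra.
Qed.

End trigonometric_integrals.

(** * Laws of binary processes *)

Definition all_ones (l : seq int) : set (int -> bool) :=
  [set eta | forall y, y \in l -> eta y = true].

Lemma all_ones_cons y l :
  all_ones (y :: l) =
  (fun eta : int -> bool => eta y) @^-1` [set true] `&` all_ones l.
Proof.
apply/seteqP; split=> eta /=.
  by move=> H; split=> [|z zl]; apply: H; rewrite in_cons ?eqxx ?zl ?orbT.
by move=> [ey el] z; rewrite in_cons => /orP[/eqP ->|/el].
Qed.

Lemma all_ones_nil : all_ones [::] = setT.
Proof. by apply/seteqP; split. Qed.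

Lemma measurable_all_ones l :
  measurable (all_ones l : set (sequence_space bool)).
Proof.
elim: l => [|y l IH]; first by rewrite all_ones_nil.
rewrite all_ones_cons; apply: measurableI => //.
by apply: sub_sigma_algebra; exists y, [set true].
Qed.

Lemma all_ones_generate :
  (measurable : set (set (sequence_space bool))) = <<s range all_ones >>.
Proof.
rewrite eqEsubset; split.
  apply: smallest_sub; first exact: smallest_sigma_algebra.
  move=> _ [y [A [_ ->]]].
  pose one := (fun eta : int -> bool => eta y) @^-1` [set true].
  have mt : <<s range all_ones >> one.
    apply: sub_sigma_algebra; exists [:: y] => //.
    by rewrite all_ones_cons all_ones_nil setIT.
  have [| | |] := set_bool A => /eqP ->.
  - exact: mt.
  - rewrite (_ : _ @^-1` [set false] = setT `\` one).
      exact: sigma_algebraCD.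
    apply/seteqP; split=> eta /=; first by rewrite /one /= => ->; split.
    by rewrite /one /= => -[_]; case: (eta y).
  - by rewrite preimage_set0; exact: sigma_algebra0.
  - rewrite preimage_setT -[X in _ X]setD0.
    by apply: sigma_algebraCD; exact: sigma_algebra0.
apply: smallest_sub; first exact: sigma_algebra_measurable.
by move=> _ [l _ <-]; exact: measurable_all_ones.
Qed.

(** Intersecting two events of ones amounts to concatenating the lists of
    sites, so these events form a pi-system. *)
Lemma law_unique (R : realType)
    (m1 m2 : {measure set (sequence_space bool) -> \bar R}) :
  (m1 setT < +oo)%E -> (forall l, m1 (all_ones l) = m2 (all_ones l)) ->
  forall C, measurable C -> m1 C = m2 C.
Proof.
move=> m1T m12.
apply: (@finite_measure_unique _ (sequence_space bool) R
  (range all_ones) m1 m2) => //.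
- exact: all_ones_generate.
- move=> _ _ [l1 _ <-] [l2 _ <-]; exists (l1 ++ l2) => //.
  apply/seteqP; split=> eta /=.
    by move=> H; split=> y yl; apply: H; rewrite mem_cat yl ?orbT.
  by move=> [H1 H2] y; rewrite mem_cat => /orP[/H1|/H2].
- by move=> _ [l _ <-].
- by rewrite -all_ones_nil.
Qed.

Lemma measurable_path_of d d' (Om : measurableType d) (T : measurableType d')
    (X : int -> Om -> T) : (forall i, measurable_fun setT (X i)) ->
  measurable_fun setT (path_of X : Om -> sequence_space T).
Proof.
move=> mX; apply: (@measurability _ _ Om (sequence_space T) setT (path_of X)
  (@coordinate_events d' T)) => //.
move=> _ [_ [i [A [mA ->]] <-]].
by apply: mX.
Qed.

Lemma sites_window (p : pred int) n m :
  exists s, forall y, (y \in sites m s) = (m <= y < m + n%:Z) && p y.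
Proof.
elim: n m => [|n IH] m; first by exists [::] => y; rewrite in_nil; lia.
have [s sE] := IH (m + 1); exists (p m :: s) => y /=.
have [->|ym] := eqVneq y m.
  have -> : (m <= m < m + n.+1%:Z) = true by lia.
  case: (p m); first by rewrite in_cons eqxx.
  by rewrite sE; lia.
case: (p m); rewrite ?in_cons ?(negbTE ym)/= sE; congr (_ && _); lia.
Qed.

(** A finite set of sites is a pattern on a window that contains it, to which
    the recursions along patterns apply. *)
Lemma sites_cover (l : seq int) : exists m s, sites m s =i l.
Proof.
pose N := (\max_(y <- l) `|y|)%N.
have [s sE] := sites_window (mem l) (N + N).+1 (- N%:Z).
exists (- N%:Z), s => y; rewrite sE /=.
apply: andb_idl => yl.
have : (`|y| <= N)%N.
  exact: (@leq_bigmax_seq _ l xpredT (fun y : int => `|y|%N)).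
by lia.
Qed.

Lemma determinantal_all_ones (R : realType) (f : R -> R) (beta x : R)
    (Pf : probability (sequence_space bool) R) m s :
  determinantal_measure f Pf ->
  (forall k : int, 1 < `|k| -> fourier_coef f k = 0) ->
  fourier_coef f 0 = beta%:C ->
  fourier_coef f 1 * fourier_coef f (-1) = (x ^+ 2 / 4)%:C ->
  Pf (all_ones (sites m s)) = (prob_pattern beta x s)%:E.
Proof.
move=> det t0 tb tx.
have E := minor_sites m s t0 tb tx.
have mS := measurable_all_ones (sites m s).
have setE : all_ones (sites m s) =
    [set eta | forall i : 'I_(size (sites m s)), eta ((sites m s)`_i) = true].
  apply/seteqP; split=> eta /= H; first by move=> i; apply: H; exact: mem_nth.
  move=> y ys; have := H (Ordinal (etrans (index_mem y _) ys)).
  by rewrite /= nth_index.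
rewrite setE in mS *.
(* The determinantal formula covers nonempty sets only. *)
case: (posnP (size (sites m s))) => [s0|s0].
  have s0' : sites m s = [::] by apply/eqP; rewrite -size_eq0 s0.
  move: E; rewrite s0' minor_nil => -[<-].
  rewrite -[RHS](probability_setT Pf); congr (Pf _).
  by apply/seteqP; split=> // eta _ [].
have inj : injective (fun i : 'I_(size (sites m s)) => (sites m s)`_i).
  move=> i j /eqP; rewrite nth_uniq ?sites_uniq// => /eqP ij; exact: val_inj.
have := det _ _ s0 inj; rewrite -[RHS]/(minor (fourier_coef f) (sites m s)) E.
by move=> [<-]; rewrite fineK// fin_num_measure.
Qed.

Lemma ones_all_ones (R : realType) d (Om : measurableType d)
    (P : probability Om R) d' (E : measurableType d')
    (Y : int -> {RV P >-> E}) B V m s :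
  path_of (factor Y B V) @^-1` all_ones (sites m s) = ones Y B V m s.
Proof.
elim: s m => [|b s IH] m; first by apply/seteqP; split.
rewrite [sites _ _]/= [RHS]/= -IH; case: b.
  rewrite all_ones_cons; apply/seteqP; split=> w /= [fw ow]; split=> //.
  exact: fw.
by apply/seteqP; split=> w //= -[].
Qed.

(** * The four coins of a site *)

Section coins.
Variables (R : realType) (b x : R).
Hypothesis bx0 : 0 <= b - x.
Hypothesis bx1 : b + x <= 1.
Hypothesis x0 : 0 <= x.

Local Notation U := (uniform01 R).

Definition spin (y : bool * bool * bool * bool) : bool := y.1.1.1.

(** Besides the spin, a site carries coins of bias [b], [b + x] and [b - x]; the
    spins at its two ends say which one is read. *)
Definition vote (beta gamma : bool) (y : bool * bool * bool * bool) : bool :=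
  match beta, gamma with
  | false, true => y.1.2
  | true, false => y.2
  | _, _ => y.1.1.2
  end.

Lemma measurable_spin : measurable_fun setT spin.
Proof. by do 2!apply: measurableT_comp => //. Qed.

Lemma measurable_vote beta gamma : measurable_fun setT (vote beta gamma).
Proof.
by case: beta; case: gamma; rewrite /vote; do ?[apply: measurableT_comp => //].
Qed.

(** Four successive splittings.  The coin that is read comes from a later
    splitting than the spin and is therefore independent of it. *)
Lemma coins_exist :
  exists (e : measurableTypeR R -> bool * bool * bool * bool) r,
  [/\ splits U e r,
    forall beta, U (e @^-1` [set y | spin y = beta]) = (1 / 2)%:E &
    forall beta gamma,
      U (e @^-1` [set y | spin y = beta /\ vote beta gamma y = true]) =
      (success b x beta gamma / 2)%:E].
Proof.
move: bx0 bx1 x0 => bx0' bx1' x0'.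
have h01 : 0 <= (1 / 2 : R) <= 1 by lra.
have b01 : 0 <= b <= 1 by lra.
have u01 : 0 <= b + x <= 1 by lra.
have d01 : 0 <= b - x <= 1 by lra.
have S1 := splits_bernoulli h01.
have S2 := splits_pair S1 (splits_bernoulli b01).
have S3 := splits_pair S2 (splits_bernoulli u01).
have S4 := splits_pair S3 (splits_bernoulli d01).
have half beta :
    U [set y : measurableTypeR R | (y < 1 / 2) = beta] = (1 / 2)%:E.
  by rewrite uniform01_below//; case: beta; congr EFin; field.
have msp beta : measurable [set y : bool | y = beta] by [].
have msp1 beta : measurable [set y : bool * bool | y.1 = beta].
  exact: (measurable_preimage measurable_fst (msp beta)).
have msp2 beta : measurable [set y : bool * bool * bool | y.1.1 = beta].
  exact: (measurable_preimage measurable_fst (msp1 beta)).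
have mb p := @measurable_below R p.
eexists; eexists; split; first exact: S4.
  exact: half.
have L2 beta := splits_law_pair true S1 (mb b) (msp beta).
have L3 beta := splits_law_pair true S2 (mb (b + x)) (msp1 beta).
have L4 beta := splits_law_pair true S3 (mb (b - x)) (msp2 beta).
move=> beta gamma; rewrite /success /vote.
case: beta; case: gamma.
- apply: etrans (L2 true) _.
  rewrite [X in (X * _)%E]half (@uniform01_below _ _ true)//.
  by rewrite -EFinM; congr EFin; rewrite /=; field.
- apply: etrans (L4 true) _.
  rewrite [X in (X * _)%E]half (@uniform01_below _ _ true)//.
  by rewrite -EFinM; congr EFin; rewrite /=; field.
- apply: etrans (L3 false) _.
  rewrite [X in (X * _)%E]half (@uniform01_below _ _ true)//.
  by rewrite -EFinM; congr EFin; rewrite /=; field.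
- apply: etrans (L2 false) _.
  rewrite [X in (X * _)%E]half (@uniform01_below _ _ true)//.
  by rewrite -EFinM; congr EFin; rewrite /=; field.
Qed.
End coins.

Lemma measurable_spin_eq s : measurable [set y | spin y = s].
Proof. exact: (measurable_preimage measurable_spin (A := [set s]) I). Qed.

Lemma measurable_vote_eq s1 s2 :
  measurable [set y | spin y = s1 /\ vote s1 s2 y = true].
Proof.
apply: measurableI; first exact: measurable_spin_eq.
exact: (measurable_preimage (measurable_vote s1 s2) (A := [set true]) I).
Qed.

Definition rule (y : 2.-tuple (bool * bool * bool * bool)) : bool :=
  vote (spin (tnth y ord0)) (spin (tnth y (lift ord0 ord0))) (tnth y ord0).

Lemma measurable_rule : measurable_fun setT rule.
Proof.
have mT (i : 'I_2) g : measurable_fun setT g ->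
    measurable_fun setT
      (fun y : 2.-tuple (bool * bool * bool * bool) => g (tnth y i) : bool).
  by move=> mg; apply: measurableT_comp => //; exact: measurable_tnth.
pose l0 := lift (@ord0 1) ord0.
rewrite [X in measurable_fun _ X](_ : _ = fun y : 2.-tuple _ =>
  if spin (tnth y ord0)
  then (if spin (tnth y l0) then vote true true (tnth y ord0)
        else vote true false (tnth y ord0))
  else (if spin (tnth y l0) then vote false true (tnth y ord0)
        else vote false false (tnth y ord0))).
  do ![apply: measurable_fun_ifT]; apply: mT; try exact: measurable_spin;
    exact: measurable_vote.
by apply/funext => y; rewrite /rule; case: spin; case: spin.
Qed.

(** * The theorem *)

Theorem theorem1p3 (R : realType) (a b c : R[i]) (f : R -> R)
  (f_trig : forall x : R, x \in `[0, 1] ->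
     (f x)%:C = b + a * expi (- (2 * pi * x)) + c * expi (2 * pi * x))
  (f_01 : forall x : R, x \in `[0, 1] -> 0 <= f x <= 1)
  (Pf : probability (sequence_space bool) R)
  (Pf_det : determinantal_measure f Pf)
  (d : measure_display) (Omega : measurableType d) (P : probability Omega R)
  (X : int -> {RV P >-> bool})
  (X_law : has_law P X Pf) :
  two_block_factor X.
Proof.
pose beta := complex.Re b.
pose u := complex.Re a + complex.Re c.
pose v := complex.Im a - complex.Im c.
have fE y : y \in `[0, 1] ->
    f y = beta + u * cos (2 * pi * y) + v * sin (2 * pi * y).
  move=> /f_trig; rewrite /beta /u /v.
  case: (a) (b) (c) => [a1 a2] [b1 b2] [c1 c2].
  by rewrite /expi /= cosN sinN => -[-> _]; ring.
have := trig_amplitude fE f_01; set x := Num.sqrt _ => -[bx0 bx1].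
have x2 : x ^+ 2 = u ^+ 2 + v ^+ 2 by rewrite sqr_sqrtr// addr_ge0// sqr_ge0.
have t_far (k : int) : 1 < `|k| -> fourier_coef f k = 0.
  move=> k1; rewrite (fourier_coef_trig k fE).
  have -> : (k == 0) = false by lia.
  have -> : (k + 1 == 0) = false by lia.
  have -> : (k - 1 == 0) = false by lia.
  by rewrite !mulr0 !addr0 subrr.
have t_0 : fourier_coef f 0 = beta%:C.
  by rewrite (fourier_coef_trig 0 fE) /= !mulr0 !addr0 subrr mulr1.
have t_1 : fourier_coef f 1 * fourier_coef f (-1) = (x ^+ 2 / 4)%:C.
  rewrite !(fourier_coef_trig _ fE) /= x2; congr (_ +i* _); by field.
have [e [r [er spin_law vote_law]]] := coins_exist bx0 bx1 (sqrtr_ge0 _).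
pose Y := splits_process er.
have Y_iid := splits_process_iid er; have [Y_indep _] := Y_iid.
have Y_law i A : measurable A -> uniform01 R (Y i @^-1` A) =
  uniform01 R (e @^-1` A) by exact: draw_law.
pose h : {mfun 2.-tuple (bool * bool * bool * bool) >-> bool} :=
  mfun_Sub (mem_set measurable_rule).
eexists; exists (measurableTypeR R), (uniform01 R).
eexists; exists (bool * bool * bool * bool)%type, Y, h; split => // C mC.
pose X' := factor Y spin vote.
have -> : (fun (i : int) w => h [tuple Y (i + k%:Z) w | k < 2]) = X'.
  apply/funext => i; apply/funext => w.
  by rewrite /h /= /rule !tnth_mktuple /= addr0.
rewrite X_law//.
have mX' : measurable_fun setT (path_of X' : _ -> sequence_space bool).
  by apply: measurable_path_of => i; apply: measurable_factor;
    [exact: measurable_spin|exact: measurable_vote].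
pose law' : {measure set (sequence_space bool) -> \bar R} :=
  pushforward (uniform01 R) (path_of X' : _ -> sequence_space bool).
have Pf_fin : (Pf setT < +oo)%E by rewrite probability_setT ltry.
apply: (@law_unique R Pf (law' mX')) => //.
move=> l; have [m [s sl]] := sites_cover l.
have -> : all_ones l = all_ones (sites m s).
  by apply/seteqP; split=> eta H y yl; apply: H; rewrite ?sl// -sl.
transitivity (prob_pattern beta x s)%:E.
  exact: (determinantal_all_ones m s Pf_det t_far t_0 t_1).
rewrite -[RHS]/(uniform01 R (path_of X' @^-1` all_ones (sites m s))).
rewrite ones_all_ones; apply/esym; apply: (prob_ones Y_indep).
- exact: measurable_spin.
- exact: measurable_vote.
- move=> i s1.
  exact: (etrans (Y_law i _ (measurable_spin_eq s1)) (spin_law s1)).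
- move=> i s1 s2.
  exact: (etrans (Y_law i _ (measurable_vote_eq s1 s2)) (vote_law s1 s2)).
Qed.
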